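(* Let $d,m\ge1$ be integers, $0<\pi\le 1/2$, $\delta\in(0,1)$, $\Delta>0$, $\sigma_{\mathrm{out}}>0$, $\epsilon\in(0,\Delta)$, and let $\bar\nabla_{\mathrm{in}}\in\mathbb{R}^d$ be the fixed reference gradient. Let $G_1,\dots,G_m$ be the gradients of the wild samples under the Huber contamination model with contamination proportion $\pi$, with true InD index set $\mathcal I$, true OOD index set $\mathcal O$, $M_{\mathrm{in}}=|\mathcal I|$ and $M_{\mathrm{out}}=|\mathcal O|$. Assume: (i) the OOD gradients $\{G_i\}_{i\in\mathcal O}$ are i.i.d., and there is $\mu_{\mathrm{out}}\in\mathbb{R}^d$ such that for each $i\in\mathcal O$ and each coordinate $j$, $G_{i,j}-\mu_{\mathrm{out},j}$ is sub-Gaussian with variance proxy $\sigma_{\mathrm{out}}^2$; (ii) $\|\mu_{\mathrm{out}}-\bar\nabla_{\mathrm{in}}\|_2\ge\Delta\sqrt d$; (iii) the element-wise median of the true InD gradients in the wild set is $\epsilon$-accurate: $\|\mathrm{EWM}(G_{\mathcal I})-\bar\nabla_{\mathrm{in}}\|_2<\epsilon\sqrt d$ (almost surely). If $$m\ \ge\ \frac{2\log(2/\delta)}{\pi^2},$$ then, with probability at least $1-\delta$, the ideal filter $$\mathcal{S}^\star\in\arg\min_{\mathcal{S}\subseteq\{1,\dots,m\},\ |\mathcal{S}|=M_{\mathrm{in}}}\big\|\mathrm{EWM}(G_{\mathcal S})-\bar\nabla_{\mathrm{in}}\big\|_2$$ satisfies $$\mathrm{ERR}_{\mathrm{out}}:=\frac{|\mathcal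 S^\star\cap\mathcal O|}{M_{\mathrm{out}}}\ \le\ 2d\exp\!\left(-\frac{(\Delta-\epsilon)^2}{2\sigma_{\mathrm{out}}^2}\right)+\frac{2}{\pi^2}\sqrt{\frac{\log(2/\delta)}{2m}}+\frac{1-\pi}{2\pi}.$$
   Context: Wild data and Huber contamination model: there are $m$ independent wild samples $\tilde x_1,\dots,\tilde x_m$ drawn from $\mathbb{P}_{\mathrm{wild}}=(1-\pi)\mathbb{P}_{\mathrm{in}}+\pi\mathbb{P}_{\mathrm{out}}$, where $\mathbb{P}_{\mathrm{in}},\mathbb{P}_{\mathrm{out}}$ are probability distributions on an input space $\mathcal X$: independently for each $i$, sample $i$ is in-distribution (InD, drawn from $\mathbb{P}_{\mathrm{in}}$) with probability $1-\pi$ and out-of-distribution (OOD, drawn from $\mathbb{P}_{\mathrm{out}}$) with probability $\pi$. This partitions the index set $\{1,\dots,m\}$ (identified with $\mathcal{S}_{\mathrm{wild}}$) into the random true InD subset $\mathcal I$ and true OOD subset $\mathcal O$, of random sizes $M_{\mathrm{in}}=|\mathcal I|$ and $M_{\mathrm{out}}=|\mathcal O|$, with $M_{\mathrm{in}}+M_{\mathrm{out}}=m$ and $M_{\mathrm{out}}\sim\mathrm{Bin}(m,\pi)$. Gradients: $G_i=\nabla\ell(f(\tilde x_i),\hat y_{\tilde x_i})\in\mathbb{R}^d$ is the loss gradient (with respect to model parameters) of wild sample $i$ for a fixed, already trained classifier $f$, where $\hat y_{\tilde x_i}$ is the label predicted by $f$; for the purposes of the statement, $G_i$ is a fixed measurable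 function of $\tilde x_i$. $G_{i,j}$ is the $j$-th coordinate of $G_i$. The reference gradient $\bar\nabla_{\mathrm{in}}\in\mathbb{R}^d$ (the mean loss gradient over a separate labeled InD training set) is a fixed, non-random vector. Distributional assumptions on $\{G_i\}_{i\in\mathcal O}$ are understood conditionally on the InD/OOD labels of the samples. Element-wise median: for a nonempty $\mathcal S\subseteq\{1,\dots,m\}$, $G_{\mathcal S}=\{G_i\}_{i\in\mathcal S}$ and $\mathrm{EWM}(G_{\mathcal S})\in\mathbb{R}^d$ is the vector whose $j$-th coordinate is the median of the numbers $\{G_{i,j}: i\in\mathcal S\}$ (for an even number of values, a fixed convention choosing a point between the two middle order statistics). Sub-Gaussian with variance proxy $\sigma^2$: a real random variable $X$ with $\mathbb{E}[e^{\lambda X}]\le e^{\lambda^2\sigma^2/2}$ for all $\lambda\in\mathbb{R}$. $\mathcal S^\star$ denotes any minimizer (ties broken arbitrarily). If $M_{\mathrm{in}}=0$, then $\mathcal S^\star=\emptyset$ and hypothesis (iii) is vacuous. $\mathrm{ERR}_{\mathrm{out}}$ is defined only when $M_{\mathrm{out}}\ge1$; the event of probability at least $1-\delta$ is understood to be contained in $\{M_{\mathrm{out}}\ge1\}$. *)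

(* Defs.v *)
From mathcomp Require Import all_boot all_order all_algebra.
From mathcomp Require Import all_classical all_reals all_analysis.
Set Implicit Arguments.
Unset Strict Implicit.
Unset Printing Implicit Defensive.
Import Order.TTheory GRing.Theory Num.Theory.
Import numFieldNormedType.Exports.
Local Open Scope classical_set_scope.
Local Open Scope ring_scope.

(* Vectors of R^d are tuples, because the library equips [d.-tuple R] with its
   product Borel sigma-algebra (and has none on row vectors). *)
Definition l2dist (R : realType) (d : nat) (u v : d.-tuple R) : R :=
  Num.sqrt (\sum_(j < d) (tnth u j - tnth v j) ^+ 2).

(* The two arguments given to [mid] are the two middle order statistics of [s];
   they coincide when [size s] is odd. *)
Definition median (R : realType) (mid : R -> R -> R) (s : seq R) : R :=
  let t := sort <=%R s in mid t`_(size s).-1./2 t`_(size s)./2.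

Definition median_convention (R : realType) (mid : R -> R -> R) : Prop :=
  forall a b : R, a <= b -> a <= mid a b <= b.

(* Meaningful for nonempty [S] only. *)
Definition EWM (R : realType) (mid : R -> R -> R) (d m : nat)
    (G : 'I_m -> d.-tuple R) (S : {set 'I_m}) : d.-tuple R :=
  [tuple median mid [seq tnth (G i) j | i <- enum S] | j < d].

Definition ideal_filter (R : realType) (mid : R -> R -> R) (d m : nat)
    (G : 'I_m -> d.-tuple R) (ref : d.-tuple R) (k : nat) (S : {set 'I_m}) :
    Prop :=
  #|S| = k /\
  forall S' : {set 'I_m}, #|S'| = k ->
    l2dist (EWM mid G S) ref <= l2dist (EWM mid G S') ref.

Definition err_out (R : realType) (m : nat) (S O : {set 'I_m}) : R :=
  #|S :&: O|%:R / #|O|%:R.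

Definition mutually_independent d1 d2 (T : measurableType d1)
    (T' : measurableType d2) (R : realType) (P : probability T R)
    (I : finType) (J : {set I}) (Y : I -> T -> T') : Prop :=
  forall K : {set I}, K \subset J ->
  forall B : I -> set T', (forall i, measurable (B i)) ->
  P (\bigcap_(i in [set` K]) Y i @^-1` B i) =
    (\prod_(i in K) P (Y i @^-1` B i))%E.

Definition identically_distributed d1 d2 (T : measurableType d1)
    (T' : measurableType d2) (R : realType) (P : probability T R)
    (I : finType) (J : {set I}) (Y : I -> T -> T') : Prop :=
  forall i k, i \in J -> k \in J ->
  forall B : set T', measurable B -> P (Y i @^-1` B) = P (Y k @^-1` B).

Definition sub_gaussian d1 (T : measurableType d1) (R : realType)
    (P : probability T R) (X : T -> R) (proxy : R) : Prop :=
  forall l : R, ('M_P X l <= (expR (l ^+ 2 * proxy / 2))%:E)%E.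

(* [mnormalize] divides [P (_ `&` E)] by [P E]; its last argument is only the
   junk value taken when [P E = 0]. *)
Definition conditioned d1 (T : measurableType d1) (R : realType)
    (P : probability T R) (E : set T) (mE : measurable E) : probability T R :=
  mnormalize (mrestr P mE) P.

Definition ood_set (T : Type) (m : nat) (ood : 'I_m -> T -> bool) (w : T) :
    {set 'I_m} := [set i | ood i w]%SET.

Definition ind_set (T : Type) (m : nat) (ood : 'I_m -> T -> bool) (w : T) :
    {set 'I_m} := (~: ood_set ood w)%SET.

Lemma measurable_ood_set d1 (T : measurableType d1) (m : nat)
    (ood : 'I_m -> {mfun T >-> bool}) (A : {set 'I_m}) :
  measurable [set w | ood_set ood w = A].
Proof.
have -> : [set w | ood_set ood w = A] =
    \bigcap_(i in [set: 'I_m]) (ood i @^-1` [set i \in A]).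
  apply/seteqP; split=> w /=.
    by move=> <- i _ /=; rewrite inE.
  by move=> h; apply/setP => i; rewrite inE; exact: h.
apply: fin_bigcap_measurable => // i _.
by rewrite -[X in measurable X]setTI; exact: measurable_funP.
Qed.

(* [ood i w] says that sample [i] was drawn from [Pout]; the marginal law of
   each [x i] is then the mixture [(1 - p) Pin + p Pout]. *)
Definition huber_model d1 d2 (T : measurableType d1) (X : measurableType d2)
    (R : realType) (P : probability T R) (p : R) (Pin Pout : probability X R)
    (m : nat) (ood : 'I_m -> T -> bool) (x : 'I_m -> T -> X) : Prop :=
  [/\ mutually_independent P [set: 'I_m]%SET (fun i w => (ood i w, x i w)),
      forall i (A : set X), measurable A ->
        P [set w | ood i w = false /\ A (x i w)] = ((1 - p)%:E * Pin A)%E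
    & forall i (A : set X), measurable A ->
        P [set w | ood i w = true /\ A (x i w)] = (p%:E * Pout A)%E].

Definition ood_iid_sub_gaussian d1 (T : measurableType d1) (R : realType)
    (P : probability T R) (d m : nat) (ood : 'I_m -> {mfun T >-> bool})
    (G : 'I_m -> T -> d.-tuple R) (mu : d.-tuple R) (proxy : R) : Prop :=
  forall O : {set 'I_m}, (0 < P [set w | ood_set ood w = O])%E ->
  let PO := conditioned P (measurable_ood_set ood O) in
  [/\ mutually_independent PO O G,
      identically_distributed PO O G
    & forall i, i \in O -> forall j : 'I_d,
        sub_gaussian PO (fun w => tnth (G i w) j - tnth mu j) proxy].

(* Main.v *)
(* The filter does at least as well as the true InD set, so its median is within
   [eps * sqrt d] of the reference, hence farther than [t = Delta - eps] from
   [mu_out] in some coordinate. A median that far off forces half of [Sstar] to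
   be [t]-far from [mu_out], and each such point is either InD or one of the [N]
   OOD points that are [t]-far from their mean; as [#|Sstar| = M_in], this gives
   [#|Sstar :&: O| <= N + M_in / 2].
   Conditionally on the labels, Chernoff and Hoeffding bound [N / M_out] by
   [2 d exp (- t^2 / (2 sigma^2)) + sqrt (L / (2 M_out))], [L = ln (2 / delta)];
   Hoeffding for the labels gives [M_out > m (p - h)], [h = sqrt (L / (2 m))].
   The hypothesis on [m] says [h <= p / 2], which turns both errors into
   multiples of [h / p^2]. *)
Require Import Defs.
From mathcomp Require Import all_boot all_order all_algebra.
From mathcomp Require Import all_classical all_reals all_analysis.
From mathcomp Require Import measurable_realfun ring lra zify.
Import Order.TTheory GRing.Theory Num.Theory.
Import numFieldNormedType.Exports.
Local Open Scope classical_set_scope.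
Local Open Scope ring_scope.
Set Implicit Arguments.
Unset Strict Implicit.
Unset Printing Implicit Defensive.

(** * Moment generating function of a Bernoulli variable *)

Lemma is_derive1_ge0_le (R : realType) (f f' : R -> R) (l : R) :
  (forall x : R, is_derive x 1 f (f' x)) -> (forall x, 0 <= x -> 0 <= f' x) ->
  0 <= l -> f 0 <= f l.
Proof.
move=> df f'_ge0 l0.
have dfx x : derivable f x 1 by apply: ex_derive; exact: df.
apply: (@ger0_derive1_ndecry R f 0) => //.
- move=> x; rewrite in_itv/= andbT => x0.
  rewrite derive1E (@derive_val _ _ _ _ _ _ _ (df x)).
  exact/f'_ge0/ltW.
- apply: continuous_subspaceT => x.
  exact/differentiable_continuous/derivable1_diffP.
Qed.

(** Hoeffding's lemma for a Bernoulli variable. Let [f] be the exponent on the right minus the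
    logarithm [ln D] of the left side. Then [f] and [f'] vanish at 0, and [f'' >= 0] because
    [(1 - q) * (q * expR x) <= D x ^+ 2 / 4] by AM-GM. Two integrations from 0 give [0 <= f l]. *)
Lemma bernoulli_mgf_le (R : realType) (q l : R) : 0 <= q <= 1 -> 0 <= l ->
  1 - q + q * expR l <= expR (l * q + l ^+ 2 / 8).
Proof.
move=> /andP[q0 q1] l0.
pose D (x : R) := 1 - q + q * expR x.
have D0 x : 0 < D x.
  rewrite /D; have := expR_gt0 x; have [->|qn0] := eqVneq q 0; first by lra.
  have : 0 < q by rewrite lt0r qn0.
  by move=> q0' e0; have := mulr_gt0 q0' e0; lra.
pose f (x : R) := x * q + x ^+ 2 / 8 - ln (D x).
pose f1 (x : R) := q + x / 4 - q * expR x / D x.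
pose f2 (x : R) := 4^-1 - (1 - q) * (q * expR x) / D x ^+ 2.
have dD (x : R) : is_derive x 1 D (q * expR x).
  have -> : D = (cst (1 - q)) \+ q *: expR by apply/funext => y.
  by apply: is_derive_eq; rewrite add0r.
have df (x : R) : is_derive x 1 f (f1 x).
  have -> : f = (q *: id + 8^-1 *: (id ^+ 2)) - (@ln R \o D).
    by apply/funext => y; rewrite /f /= !fctE /GRing.scale/=; lra.
  have H := @is_derive1_comp _ _ _ _ _ _ (is_derive1_ln (D0 x)) (dD x).
  apply: is_derive_eq.
  by rewrite /f1 /GRing.scale /= /GRing.scale /=; field; rewrite gt_eqF.
have df1 (x : R) : is_derive x 1 f1 (f2 x).
  have -> : f1 = cst (q - 1) + 4^-1 *: id + (1 - q) *: (fun y => (D y)^-1).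
    apply/funext => y; rewrite /f1 /= !fctE /GRing.scale/=.
    have -> : q * expR y = D y - (1 - q) by rewrite /D; ring.
    by field; rewrite gt_eqF.
  have H := is_deriveV (lt0r_neq0 (D0 x)) (dD x).
  apply: is_derive_eq.
  by rewrite /f2 /GRing.scale /= /GRing.scale /=; field; rewrite gt_eqF.
have f2_ge0 x : 0 <= f2 x.
  rewrite subr_ge0 ler_pdivrMr ?exprn_gt0// /D.
  rewrite -subr_ge0.
  have -> : 4^-1 * (1 - q + q * expR x) ^+ 2 - (1 - q) * (q * expR x) =
    4^-1 * (1 - q - q * expR x) ^+ 2 by field.
  by rewrite mulr_ge0 ?sqr_ge0// invr_ge0.
have f1_ge0 x : 0 <= x -> 0 <= f1 x.
  move=> x0.
  have H : f1 0 <= f1 x := is_derive1_ge0_le df1 (fun y _ => f2_ge0 y) x0.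
  apply: le_trans H.
  by rewrite /f1 /D expR0 mul0r addr0 mulr1 subrK divr1 subrr.
have := is_derive1_ge0_le df f1_ge0 l0.
rewrite /f {1}/D expR0 mul0r mulr1 subrK ln1 expr0n/= mul0r addr0 subrr subr_ge0.
by rewrite -ler_expR lnK ?posrE ?D0.
Qed.

(** * Hoeffding's inequality for counts of independent events *)

Lemma le_measure_cover d (T : measurableType d) (R : realType)
    (mu : {measure set T -> \bar R}) (I : finType) (Q : pred I) (A : set T)
    (F : I -> set T) :
  measurable A -> (forall i, measurable (F i)) ->
  (forall w, A w -> exists2 i, Q i & F i w) ->
  (mu A <= \sum_(i | Q i) mu (F i))%E.
Proof.
move=> mA mF AF.
have [mU leU] : measurable (\big[setU/set0]_(i | Q i) F i) /\
    (mu (\big[setU/set0]_(i | Q i) F i) <= \sum_(i | Q i) mu (F i))%E.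
  pose K (B : set T) (x : \bar R) := measurable B /\ (mu B <= x)%E.
  apply: (big_ind2 K) => [|B x C y [mB Bx] [mC Cy]|i _]; rewrite /K.
  - by rewrite measure0.
  - split; first exact: measurableU.
    by apply: le_trans (measureU2 mu mB mC) _; exact: leeD.
  - by [].
apply: le_trans leU; apply: le_measure; rewrite ?inE//.
by move=> w /AF[i Qi Fiw]; rewrite (bigD1 i)//=; left.
Qed.

(** Generating function of the number of successes in independent trials: expanding the product on
    the right picks, for each index of [J], the success term (index in [K]) or the failure term. *)
Lemma sum_subset_prod_expn (R : comPzRingType) (I : finType) (J : {set I})
    (a : I -> R) (e : R) :
  \sum_(K : {set I} | K \subset J)
    (\prod_(i in J) (if i \in K then a i else 1 - a i)) * e ^+ #|K| =
  \prod_(i in J) (1 - a i + a i * e).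
Proof.
pose f i := if i \in J then a i * e else 0.
pose g i := if i \in J then 1 - a i else 1.
have -> : \prod_(i in J) (1 - a i + a i * e) = \prod_i (f i + g i).
  rewrite big_mkcond; apply: eq_bigr => i _; rewrite /f /g.
  by case: ifP => _; rewrite ?add0r// addrC.
rewrite bigA_distr [RHS](bigID (fun K : {set I} => K \subset J)) /=.
rewrite [X in _ = _ + X]big1 ?addr0 => [|K /subsetPn[i iK iJ]]; last first.
  by rewrite (bigD1 i)//= iK /f (negbTE iJ) mul0r.
apply: eq_bigr => K KJ.
have -> : e ^+ #|K| = \prod_(i in J) (if i \in K then e else 1).
  rewrite -big_mkcondr -prodr_const; apply: eq_bigl => i.
  by rewrite andbC; case: (boolP (i \in K)) => // /(fintype.subsetP KJ) ->.
rewrite -big_split [LHS]big_mkcond; apply: eq_bigr => i _ /=.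
have := fintype.subsetP KJ i; rewrite /f /g.
case: (i \in K) => [->//|_].
by case: ifP => _; rewrite ?mulr1.
Qed.

(** The whole set of successes is kept, not only its size: under independence the probability of
    each value is a product. It serves both for the InD labels and for the far OOD points. *)
Definition hits (I : finType) (T T' : Type) (J : {set I}) (Y : I -> T -> T')
    (c : T' -> bool) (w : T) : {set I} := [set i in J | c (Y i w)]%SET.

Section independent_hits.
Context d1 d2 (T : measurableType d1) (T' : measurableType d2) (R : realType)
  (P : probability T R) (I : finType) (J : {set I}) (Y : I -> T -> T')
  (c : T' -> bool).
Hypotheses (mY : forall i, measurable_fun setT (Y i))
  (mc : measurable [set y | c y]).

Lemma measurable_hit i : measurable [set w | c (Y i w)].
Proof. by have := mY i measurableT mc; rewrite setTI. Qed.

Lemma hits_eqE (K : {set I}) : (K \subset J)%SET ->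
  [set w | hits J Y c w = K] =
  \bigcap_(i in [set` J])
    Y i @^-1` (if i \in K then [set y | c y] else ~` [set y | c y]).
Proof.
move=> KJ; apply/seteqP; split => w /=.
  move=> <- i /= iJ; rewrite !inE iJ /=.
  by case: ifPn => //= /negP.
move=> h; apply/setP => i; rewrite !inE.
have [iJ|iJ] := boolP (i \in J); last first.
  by apply/esym; apply: contraNF iJ; exact: (fintype.subsetP KJ).
by have := h i iJ; case: ifPn => //= _ /negP/negbTE ->.
Qed.

Lemma measurable_hits (A : set {set I}) : measurable [set w | A (hits J Y c w)].
Proof.
have -> : [set w | A (hits J Y c w)] =
    \bigcup_(K in [set K : {set I} | (K \subset J)%SET /\ A K])
      [set w | hits J Y c w = K].
  apply/seteqP; split => w /=.
    move=> Aw; exists (hits J Y c w) => //=; split => //.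
    by apply/fintype.subsetP => i; rewrite inE => /andP[].
  by move=> [K /= [_ AK] ->].
apply: fin_bigcup_measurable => [//|K /= [KJ _]].
rewrite hits_eqE//; apply: fin_bigcap_measurable => // i _.
rewrite -[X in measurable X]setTI; apply: (mY i) => //.
by case: ifP => // _; exact: measurableC.
Qed.

Hypothesis iY : mutually_independent P J Y.

Lemma prob_hits_eq (K : {set I}) : (K \subset J)%SET ->
  P [set w | hits J Y c w = K] =
  (\prod_(i in J) (if i \in K then fine (P [set w | c (Y i w)])
    else 1 - fine (P [set w | c (Y i w)])))%:E.
Proof.
move=> KJ; rewrite hits_eqE// iY//; last first.
  by move=> i; case: ifP => // _; exact: measurableC.
rewrite -prodEFin; apply: eq_bigr => i iJ.
have mi := measurable_hit i.
case: ifP => _; first by rewrite fineK// fin_num_measure.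
rewrite preimage_setC probability_setC; last exact: mi.
by rewrite EFinB fineK// fin_num_measure.
Qed.

(** Exponential Markov, carried out on the finite law of the hit set. The success probabilities may
    differ; only the common bound [q] enters. Since [q] will come from a union bound, it may exceed
    1. *)
Lemma hoeffding_hits (q s : R) :
  (forall i, i \in J -> (P [set w | c (Y i w)] <= q%:E)%E) -> 0 <= q -> 0 <= s ->
  (P [set w | (#|J|%:R * (q + s) <= #|hits J Y c w|%:R)%R] <=
    (expR (- (2 * #|J|%:R * s ^+ 2)))%:E)%E.
Proof.
move=> Pq q0 s0.
have mE : measurable [set w | (#|J|%:R * (q + s) <= #|hits J Y c w|%:R :> R)%R].
  exact: (measurable_hits [set K : {set I} | #|J|%:R * (q + s) <= #|K|%:R]).
(* The Bernoulli estimate requires [q <= 1]. If [q > 1], either [s = 0] or [J] is empty and the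
   right side is 1, or the event is empty because there are at most [#|J|] hits. *)
have [q1|q1] := ltP 1 q.
  have [s0'|] := eqVneq s 0.
    apply: le_trans (probability_le1 P mE) _.
    by rewrite lee_fin s0' expr0n/= mulr0 oppr0 expR0.
  rewrite neq_lt ltNge s0 /= => {}s0.
  have [J0|J0] := posnP #|J|.
    apply: le_trans (probability_le1 P mE) _.
    by rewrite lee_fin J0 mulr0 mul0r oppr0 expR0.
  rewrite [X in P X](_ : _ = set0) ?measure0 ?lee_fin ?expR_ge0//.
  apply/seteqP; split => w //=; apply/negP; rewrite -ltNge.
  apply: (@le_lt_trans _ _ #|J|%:R).
    rewrite ler_nat; apply: subset_leq_card; apply/fintype.subsetP => i.
    by rewrite inE => /andP[].
  by rewrite ltr_pMr ?ltr0n//; lra.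
pose a i := fine (P [set w | c (Y i w)]).
have a01 i : i \in J -> 0 <= a i <= q.
  move=> iJ; rewrite fine_ge0//= -lee_fin fineK ?Pq//.
  by rewrite fin_num_measure//; exact: measurable_hit.
(* [4 s] minimises the exponent [l^2 / 8 - l s]. *)
pose l := 4 * s; have l0 : 0 <= l by rewrite mulr_ge0.
pose pr (K : {set I}) := \prod_(i in J) (if i \in K then a i else 1 - a i).
have pr0 K : 0 <= pr K.
  apply: prodr_ge0 => i iJ; have := a01 _ iJ; case: ifP => _; lra.
pose C := #|J|%:R * (q + s).
apply: (@le_trans _ _
    (\sum_(K : {set I} | (K \subset J) && (C <= #|K|%:R)%R) (pr K)%:E)%E).
  rewrite (eq_bigr (fun K => P [set w | hits J Y c w = K])); last first.
    by move=> K /andP[KJ _]; rewrite prob_hits_eq.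
  apply: le_measure_cover => // [K|w /= Cw].
    exact: (measurable_hits [set K' : {set I} | K' = K]).
  exists (hits J Y c w) => //; rewrite Cw andbT.
  by apply/fintype.subsetP => i; rewrite inE => /andP[].
rewrite sumEFin lee_fin.
(* Markov step: each term with [C <= #|K|] is multiplied by [expR (l * (#|K| - C)) >= 1], and
   nonnegative terms are added for the other [K]. *)
apply: (@le_trans _ _ (expR (- (l * C)) *
    \sum_(K : {set I} | K \subset J) pr K * expR l ^+ #|K|)).
  rewrite mulr_sumr big_mkcondr; apply: ler_sum => K KJ.
  case: ifP => [CK|_]; last first.
    by rewrite !mulr_ge0 ?expR_ge0// exprn_ge0// expR_ge0.
  rewrite mulrCA ler_peMr// -expRM_natl -expRD -[leLHS]expR0 ler_expR.
  by rewrite addrC subr_ge0 mulrC ler_wpM2r.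
rewrite sum_subset_prod_expn.
apply: (@le_trans _ _
    (expR (- (l * C)) * \prod_(i in J) expR (l * q + l ^+ 2 / 8))).
  rewrite ler_wpM2l ?expR_ge0//; apply: ler_prod => i iJ.
  have /andP[ai0 aiq] := a01 _ iJ.
  have e1 : 0 <= expR l - 1 by rewrite subr_ge0 -[leLHS]expR0 ler_expR.
  (* In this form the factor is visibly nondecreasing in [a i], as [l >= 0], so [a i] can be
     replaced by [q]. *)
  have -> : 1 - a i + a i * expR l = 1 + a i * (expR l - 1) by ring.
  rewrite addr_ge0 ?mulr_ge0//=.
  apply: le_trans (bernoulli_mgf_le _ l0); last by rewrite q0.
  have -> : 1 - q + q * expR l = 1 + q * (expR l - 1) by ring.
  by rewrite lerD2l ler_wpM2r.
rewrite prodr_const -expRM_natl -expRD ler_expR /C /l.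
by rewrite le_eqVlt; apply/orP; left; apply/eqP; field.
Qed.
End independent_hits.

(** * Medians and the deterministic bound on contamination *)

Lemma count_nth_ge (R : realDomainType) (s : seq R) (n : nat) (a : pred R) :
  (n <= size s)%N -> (forall k, (n <= k < size s)%N -> a s`_k) ->
  (size s - n <= count a s)%N.
Proof.
move=> ns H.
rewrite -[in count a s](cat_take_drop n s) count_cat.
suff : count a (drop n s) = (size s - n)%N by lia.
rewrite -size_drop; apply/eqP; rewrite -all_count; apply/(all_nthP 0) => k.
by rewrite size_drop nth_drop => kn; apply: H; rewrite leq_addr -ltn_subRL kn.
Qed.

Lemma count_nth_le (R : realDomainType) (s : seq R) (n : nat) (a : pred R) :
  (n <= size s)%N -> (forall k, (k < n)%N -> a s`_k) ->
  (n <= count a s)%N.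
Proof.
move=> ns H.
rewrite -[in count a s](cat_take_drop n s) count_cat.
suff : count a (take n s) = n by lia.
rewrite -[RHS](size_takel ns); apply/eqP; rewrite -all_count.
apply/(all_nthP 0) => k.
by rewrite size_takel// => kn; rewrite nth_take//; apply: H.
Qed.

(** If the median exceeds [c + t], so does every order statistic from the upper middle one on; if it
    is below [c - t], so is every one up to the lower middle one. Either range holds at least half
    of the entries, whatever the parity. *)
Lemma count_median_far (R : realType) (mid : R -> R -> R) (s : seq R) (c t : R) :
  median_convention mid -> (0 < size s)%N -> t < `|median mid s - c| ->
  (size s <= (count (fun y => (t < `|y - c|)%R) s).*2)%N.
Proof.
move=> hmid s0; rewrite /median.
set a : pred R := fun y => t < `|y - c|.
set u := sort _ s => far.
have su : size u = size s by rewrite size_sort.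
have so : sorted <=%R u by apply: sort_sorted; exact: le_total.
have -> : count a s = count a u.
  by apply/permP; rewrite perm_sym perm_sort.
have mono i k : (i <= k)%N -> (k < size u)%N -> u`_i <= u`_k.
  move=> ik ku; apply: (sorted_leq_nth le_trans lexx) => //; rewrite inE//.
  exact: leq_ltn_trans ku.
have /andP[lo hi] : u`_(size s).-1./2 <=
    mid u`_(size s).-1./2 u`_(size s)./2 <= u`_(size s)./2.
  by apply: hmid; apply: mono; rewrite ?su; lia.
move: far; rewrite ltr_normr; case/orP => far.
- have := @count_nth_ge _ u (size s)./2 a.
  rewrite su => H; suff : (size s - (size s)./2 <= count a u)%N by lia.
  apply: H => [|k /andP[k1 k2]]; first by lia.
  have := mono _ _ k1; rewrite su => /(_ k2) => h.
  by rewrite /a ltr_normr; apply/orP; left; lra.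
- have := @count_nth_le _ u (size s).-1./2.+1 a.
  rewrite su => H; suff : ((size s).-1./2.+1 <= count a u)%N by lia.
  apply: H => [|k k1]; first by lia.
  have := mono k (size s).-1./2 k1; rewrite su => h.
  have {}h := h ltac:(lia).
  by rewrite /a ltr_normr; apply/orP; right; lra.
Qed.

(** If all coordinates of [u] and [v] were [t]-close, their distance would be at most [t * sqrt d],
    and the triangle inequality through [u] would put [v] strictly closer to [w] than assumed. *)
Lemma l2dist_far_coord (R : realType) (d : nat) (u v w : d.-tuple R) (e t : R) :
  0 < e -> 0 < t -> l2dist u w < e * Num.sqrt d%:R ->
  (t + e) * Num.sqrt d%:R <= l2dist v w ->
  exists j, t < `|tnth u j - tnth v j|.
Proof.
move=> e0 t0 uw vw; apply: contrapT => near.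
have {}near j : `|tnth u j - tnth v j| <= t.
  by rewrite leNgt; apply/negP => h; apply: near; exists j.
have sq0 (a b : d.-tuple R) : 0 <= \sum_(j < d) (tnth a j - tnth b j) ^+ 2.
  by apply: sumr_ge0 => j _; exact: sqr_ge0.
have toS (a b : d.-tuple R) :
    \sum_(j < d) (tnth a j - tnth b j) ^+ 2 = l2dist a b ^+ 2.
  by rewrite /l2dist sqr_sqrtr.
have d0 : (0 < d%:R :> R).
  rewrite lt0r ler0n andbT; apply/eqP => d0; move: uw.
  by rewrite d0 sqrtr0 mulr0 ltNge sqrtr_ge0.
have : \sum_(j < d) (tnth v j - tnth w j) ^+ 2 <=
    (1 + e / t) * (t ^+ 2 * d%:R) +
    (1 + t / e) * \sum_(j < d) (tnth u j - tnth w j) ^+ 2.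
  have -> : t ^+ 2 * d%:R = \sum_(j < d) t ^+ 2.
    by rewrite sumr_const card_ord mulr_natr.
  (* Young's inequality (b - a)^2 <= (1 + e/t) a^2 + (1 + t/e) b^2 stands in for
     the triangle inequality. *)
  rewrite !mulr_sumr -big_split; apply: ler_sum => j _ /=.
  have : (tnth u j - tnth v j) ^+ 2 <= t ^+ 2.
    by rewrite -(real_normK (num_real (_ - _))) ler_sqr ?nnegrE ?normr_ge0 ?near// ltW.
  set a := tnth u j - tnth v j; set b := tnth u j - tnth w j.
  have -> : tnth v j - tnth w j = b - a by rewrite /a /b; ring.
  move=> at2.
  apply: (@le_trans _ _ ((1 + e / t) * a ^+ 2 + (1 + t / e) * b ^+ 2)).
    rewrite -subr_ge0.
    have -> : (1 + e / t) * a ^+ 2 + (1 + t / e) * b ^+ 2 - (b - a) ^+ 2 =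
      (e * a + t * b) ^+ 2 / (e * t) by field; lra.
    by rewrite divr_ge0 ?sqr_ge0// mulr_ge0// ltW.
  by rewrite lerD2r ler_wpM2l// addr_ge0// divr_ge0// ltW.
rewrite !toS; apply/negP; rewrite -ltNge.
have uw2 : l2dist u w ^+ 2 < e ^+ 2 * d%:R.
  have -> : e ^+ 2 * d%:R = (e * Num.sqrt d%:R) ^+ 2.
    by rewrite exprMn sqr_sqrtr// ltW.
  by rewrite ltr_pXn2r// ?nnegrE ?sqrtr_ge0// mulr_ge0 ?sqrtr_ge0// ltW.
have vw2 : (t + e) ^+ 2 * d%:R <= l2dist v w ^+ 2.
  have -> : (t + e) ^+ 2 * d%:R = ((t + e) * Num.sqrt d%:R) ^+ 2.
    by rewrite exprMn sqr_sqrtr// ltW.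
  by rewrite ler_pXn2r// ?nnegrE ?sqrtr_ge0// mulr_ge0 ?sqrtr_ge0// addr_ge0// ltW.
apply: lt_le_trans vw2.
(* The Young weights make this an identity, so the strict inequality [uw2] decides. *)
have -> : (t + e) ^+ 2 * d%:R =
    (1 + e / t) * (t ^+ 2 * d%:R) + (1 + t / e) * (e ^+ 2 * d%:R).
  by field; lra.
rewrite ltrD2l ltr_pM2l//.
by rewrite addr_gt0// divr_gt0.
Qed.

(** The coordinate in which the median is off depends on the filtered set; quantifying over all
    coordinates gives a test on a single gradient, at the price of a factor [d] in its
    probability. *)
Definition far (R : realType) (d : nat) (mu : d.-tuple R) (t : R)
  (g : d.-tuple R) : bool := [exists j, t < `|tnth g j - tnth mu j|].

(** At least half of [S] is far, and at most [#|S :\: O| = #|S| - #|S :&: O|] of these points are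
    InD; rearranging with [#|S| = #|~: O|] gives the bound. Doubling keeps it in [nat]. *)
Lemma filter_contamination (R : realType) (mid : R -> R -> R) (d m : nat)
    (G : 'I_m -> d.-tuple R) (ref mu : d.-tuple R) (e t : R) (O S : {set 'I_m}) :
  median_convention mid -> 0 < e -> 0 < t -> #|S| = #|~: O| ->
  ((0 < #|S|)%N -> l2dist (EWM mid G S) ref < e * Num.sqrt d%:R) ->
  (t + e) * Num.sqrt d%:R <= l2dist mu ref ->
  ((#|S :&: O|).*2 <= (#|[set i in O | far mu t (G i)]|).*2 + #|~: O|)%N.
Proof.
move=> hmid e0 t0 SO Sref muref.
(* For empty [S] the median is a default value, but then [S :&: O] is empty too. *)
have [S0|Sn0] := posnP #|S|.
  by move/eqP: S0; rewrite cards_eq0 => /eqP ->; rewrite finset.set0I cards0.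
have [j jfar] := l2dist_far_coord e0 t0 (Sref Sn0) muref.
move: jfar; rewrite /EWM tnth_mktuple => jfar.
have := count_median_far hmid _ jfar.
rewrite size_map -cardE => /(_ Sn0).
rewrite count_map -size_filter /=.
set N := size _; move=> SN.
have NE : N = #|[set i in S | (t < `|tnth (G i) j - tnth mu j|)%R]|.
  rewrite /N cardE /enum_mem -enumT /=; congr (size _).
  by rewrite -filter_predI; apply: eq_filter => i /=; rewrite !inE andbC.
set B := [set i in O | _]%SET.
have : (N <= #|B| + #|S :\: O|)%N.
  rewrite NE; apply: leq_trans (leq_card_setU B (S :\: O)%SET).
  apply: subset_leq_card; apply/fintype.subsetP => i; rewrite !inE => /andP[-> h].
  case: (i \in O) => //=; rewrite orbF.
  by apply/existsP; exists j.
have := cardsID O S.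
clearbody N B; move: SN; rewrite -SO; clear.
move: #|S :&: O| #|S :\: O| #|B| #|S| => x y b z.
lia.
Qed.

(** * Sub-Gaussian tails *)

Lemma measurable_bool_set d (T : measurableType d) (b : T -> bool) :
  measurable_fun setT b -> measurable [set w | b w].
Proof. by move=> mb; have := mb measurableT [set true] I; rewrite setTI. Qed.

(** The parameter [t / v] minimises the Chernoff exponent [l ^+ 2 * v / 2 - l * t]. *)
Lemma chernoff_gaussian d (T : measurableType d) (R : realType)
    (P : probability T R) (X : T -> R) (v t : R) :
  measurable_fun setT X -> 0 < v -> 0 < t ->
  ('M_P X (t / v) <= (expR ((t / v) ^+ 2 * v / 2))%:E)%E ->
  (P [set w | (t <= X w)%R] <= (expR (- (t ^+ 2 / (2 * v))))%:E)%E.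
Proof.
move=> mX v0 t0 MX; have tv : 0 < t / v by rewrite divr_gt0.
pose Y : {RV P >-> R} := mfun_Sub (mem_set mX).
apply: le_trans (chernoff Y t tv) _.
apply: (@le_trans _ _
    ((expR ((t / v) ^+ 2 * v / 2))%:E * (expR (- (t / v * t)))%:E)%E).
  by rewrite lee_pmul2r// lte_fin expR_gt0.
rewrite -EFinM lee_fin -expRD ler_expR le_eqVlt; apply/orP; left; apply/eqP.
by field; lra.
Qed.

Lemma sub_gaussian_tail d (T : measurableType d) (R : realType)
    (P : probability T R) (X : T -> R) (v t : R) :
  measurable_fun setT X -> 0 < v -> 0 < t -> sub_gaussian P X v ->
  (P [set w | (t < `|X w|)%R] <= (2 * expR (- (t ^+ 2 / (2 * v))))%:E)%E.
Proof.
move=> mX v0 t0 sX.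
have mN : measurable_fun setT (\- X) by exact: measurableT_comp mX.
have mle (W : T -> R) : measurable_fun setT W -> measurable [set w | (t <= W w)%R].
  by move=> mW; apply: measurable_bool_set; exact: measurable_fun_ler.
have sub : [set w | (t < `|X w|)%R] `<=`
    [set w | (t <= X w)%R] `|` [set w | (t <= (\- X) w)%R].
  by move=> w /=; rewrite ltr_normr => /orP[] /ltW; [left|right].
apply: (@le_trans _ _
    (P ([set w | (t <= X w)%R] `|` [set w | (t <= (\- X) w)%R]))).
  apply: le_measure => //; rewrite inE; last by apply: measurableU; exact: mle.
  apply: measurable_bool_set; apply: measurable_fun_ltr => //.
  exact: measurableT_comp.
apply: le_trans (measureU2 _ (mle _ mX) (mle _ mN)) _.
rewrite mulr_natl mulr2n EFinD leeD// chernoff_gaussian//.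
(* The lower tail is the upper tail of [- X], whose generating function at [t / v] is that of [X] at
   [- (t / v)]. *)
have := sX (- (t / v)).
rewrite sqrrN; congr (_ <= _)%E; rewrite /mmt_gen_fun; congr ('E_P[_])%E.
by apply/funext => w /=; rewrite mulrN mulNr.
Qed.

Lemma measurable_far (R : realType) (d : nat) (mu : d.-tuple R) (t : R) :
  measurable [set g : d.-tuple R | far mu t g].
Proof.
have -> : [set g : d.-tuple R | far mu t g] =
    \bigcup_(j in [set: 'I_d]) [set g | t < `|tnth g j - tnth mu j|].
  apply/seteqP; split => g /=; first by move/existsP => [j h]; exists j.
  by move=> [j _ h]; apply/existsP; exists j.
apply: fin_bigcup_measurable => // j _.
apply: measurable_bool_set; apply: measurable_fun_ltr => //.
apply: measurableT_comp => //; apply: measurable_funB => //.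
exact: measurable_tnth.
Qed.

Lemma sub_gaussian_far d' (T : measurableType d') (R : realType)
    (P : probability T R) (d : nat) (G : T -> d.-tuple R) (mu : d.-tuple R)
    (v t : R) :
  measurable_fun setT G -> 0 < v -> 0 < t ->
  (forall j, sub_gaussian P (fun w => tnth (G w) j - tnth mu j) v) ->
  (P [set w | far mu t (G w)] <= (2 * d%:R * expR (- (t ^+ 2 / (2 * v))))%:E)%E.
Proof.
move=> mG v0 t0 sG.
have mD j : measurable_fun setT (fun w => tnth (G w) j - tnth mu j).
  apply: measurable_funB => //.
  exact: (measurableT_comp (@measurable_tnth _ _ _ j) mG).
apply: (@le_trans _ _
    (\sum_(j < d) P [set w | (t < `|tnth (G w) j - tnth mu j|)%R])%E).
  apply: le_measure_cover.
  - rewrite -[X in measurable X]setTI.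
    exact: (mG measurableT _ (measurable_far mu t)).
  - move=> j /=; apply: measurable_bool_set; apply: measurable_fun_ltr => //.
    exact: measurableT_comp.
  - by move=> w /= /existsP[j h]; exists j.
apply: (@le_trans _ _ (\sum_(j < d) (2 * expR (- (t ^+ 2 / (2 * v))))%:E)%E).
  by apply: lee_sum => j _; exact: sub_gaussian_tail.
by rewrite sumEFin sumr_const card_ord lee_fin -[_ *+ d]mulr_natr mulrAC.
Qed.

(** * Arithmetic of the error terms *)

(** Here [M] is the sample size, [n] the number of OOD points, [a] that of OOD points kept and [N]
    that of far OOD points. With [r = M / n], the ratio is at most [q + s + (r - 1) / 2]. Both [s]
    and the excess of [r / 2] over [1 / (2 * p)] are at most [h / p ^+ 2], which explains the factor
    2. *)
Lemma err_bound (R : realType) (p h s q a N n M : R) :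
  0 < p <= 1 / 2 -> 0 <= h <= p / 2 -> 0 < n -> 0 < M ->
  0 <= s -> s ^+ 2 = h ^+ 2 * (M / n) ->
  M - n <= M * (1 - p + h) -> N <= n * (q + s) -> 2 * a <= 2 * N + (M - n) ->
  a / n <= q + 2 / p ^+ 2 * h + (1 - p) / (2 * p).
Proof.
move=> /andP[p0 p2] /andP[h0 hp] n0 M0 s0 sE Mn Nn aN.
set r := M / n in sE *.
have r0 : 0 < r by rewrite divr_gt0.
have rph : r * (p - h) <= 1.
  by rewrite /r mulrAC ler_pdivrMr// mul1r; lra.
have r2 : r <= 2 / p.
  rewrite ler_pdivlMr//.
  have : r * (p / 2) <= r * (p - h) by apply: ler_wpM2l; [exact: ltW|lra].
  by move: rph; nra.
have rle : r <= p^-1 + 2 * h / p ^+ 2.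
  rewrite -(@ler_pM2r _ (p - h)); last by lra.
  apply: le_trans rph _.
  have -> : (p^-1 + 2 * h / p ^+ 2) * (p - h) = 1 + h / p ^+ 2 * (p - 2 * h).
    by field; lra.
  by rewrite lerDl mulr_ge0 ?divr_ge0 ?exprn_ge0//; lra.
have sle : s <= h / p ^+ 2.
  rewrite -(@ler_pXn2r _ 2)// ?nnegrE ?divr_ge0 ?exprn_ge0 ?(ltW p0)// sE expr_div_n.
  rewrite ler_wpM2l ?exprn_ge0//; apply: le_trans r2 _.
  (* What remains is [2 <= 1 / p ^+ 3], true since [p <= 1 / 2]. *)
  have -> : (p ^+ 2) ^- 2 = (p ^+ 3)^-1 / p by field; lra.
  rewrite ler_pM2r ?invr_gt0// -[leLHS]invrK lef_pV2 ?posrE ?invr_gt0 ?exprn_gt0//.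
  have -> : p ^+ 3 = p * (p * p) by ring.
  by nra.
have -> : a / n = (2 * a) / (2 * n) by field; lra.
apply: (@le_trans _ _ (q + s + (r - 1) / 2)).
  rewrite ler_pdivrMr ?mulr_gt0//; apply: le_trans aN _.
  have -> : (q + s + (r - 1) / 2) * (2 * n) = 2 * (n * (q + s)) + (M - n).
    by rewrite /r; field; lra.
  by rewrite lerD2r ler_wpM2l.
have -> : (1 - p) / (2 * p) = (p^-1 - 1) / 2 by field; lra.
have -> : 2 / p ^+ 2 * h = 2 * (h / p ^+ 2) by ring.
have {}rle : r <= p^-1 + 2 * (h / p ^+ 2) by rewrite mulrA.
lra.
Qed.

(** * Conditioning on the labels and the two bad events *)

Lemma conditioned_le d1 (T : measurableType d1) (R : realType)
    (P : probability T R) (E : set T) (mE : measurable E) (A : set T) (c : R) :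
  measurable A -> (0 < P E)%E -> (conditioned P mE A <= c%:E)%E ->
  (P (A `&` E) <= c%:E * P E)%E.
Proof.
move=> mA PE; rewrite /conditioned /= /mnormalize /= /mrestr setTI.
have fE : P E \is a fin_num by exact: fin_num_measure.
rewrite gt_eqF//= lt_eqF ?ltey_eq ?fE//=.
have f0 : 0 < fine (P E) by rewrite fine_gt0// PE ltey_eq fE.
by rewrite -(fineK fE) lee_pdivrMr.
Qed.

Lemma sum_prob_fibers d (T : measurableType d) (R : realType)
    (P : probability T R) (F : finType) (Z : T -> F) :
  (forall z, measurable [set w | Z w = z]) ->
  (\sum_(z : F) P [set w | Z w = z] = 1)%E.
Proof.
move=> mZ.
rewrite bigfs ?index_enum_uniq//; last by move=> z _; rewrite mem_index_enum.
rewrite -measure_fin_bigcup//.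
  rewrite -(@probability_setT _ _ _ P); congr (P _).
  by apply/seteqP; split => // w _; exists (Z w).
by move=> z z' _ _ [w [/= <- <-]].
Qed.

(** Hoeffding is applied to the pairs of label and sample, since the model states independence for
    the pairs; the test [c] reads the label only. *)
Lemma huber_ind_tail d1 d2 (T : measurableType d1) (X : measurableType d2)
    (R : realType) (P : probability T R) (p h : R) (Pin Pout : probability X R)
    (m : nat) (ood : 'I_m -> {RV P >-> bool}) (x : 'I_m -> {RV P >-> X}) :
  huber_model P p Pin Pout ood x -> p <= 1 -> 0 <= h ->
  measurable [set w | (m%:R * (1 - p + h) <= #|ind_set ood w|%:R :> R)%R] /\
  (P [set w | (m%:R * (1 - p + h) <= #|ind_set ood w|%:R)%R] <=
    (expR (- (2 * m%:R * h ^+ 2)))%:E)%E.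
Proof.
move=> [indep Hin _] p1 h0.
pose Y i w := (ood i w, x i w).
pose c (y : bool * X) := ~~ y.1.
have mY i : measurable_fun setT (Y i) by exact/measurable_fun_pair.
have mc : measurable [set y | c y].
  apply: measurable_bool_set; apply: measurableT_comp; last exact: measurable_fst.
  exact: measurable_neg.
have IE w : ind_set ood w = hits [set: 'I_m]%SET Y c w.
  by apply/setP => i; rewrite !inE.
have Pc i : P [set w | c (Y i w)] = (1 - p)%:E.
  have -> : [set w | c (Y i w)] = [set w | ood i w = false /\ setT (x i w)].
    apply/seteqP; split => w; rewrite /c /=; first by move/negbTE.
    by case=> ->.
  by rewrite Hin// probability_setT mule1.
have -> : [set w | (m%:R * (1 - p + h) <= #|ind_set ood w|%:R :> R)%R] =
    [set w | (m%:R * (1 - p + h) <= #|hits [set: 'I_m]%SET Y c w|%:R :> R)%R].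
  by apply/funext => w /=; rewrite IE.
split.
  exact: (measurable_hits _ mY mc
    [set K : {set 'I_m} | m%:R * (1 - p + h) <= #|K|%:R]).
have := hoeffding_hits mY mc indep (q := 1 - p) (s := h).
rewrite cardsT card_ord; apply => //; last by rewrite subr_ge0.
by move=> i _; rewrite Pc.
Qed.

(** The event is split by the value [A] of the OOD set. The deviation depends on [#|A|] so that the
    Hoeffding exponent is [L] for every nonempty [A]; the conditional bounds then average to
    [expR (- L)]. *)
Lemma ood_far_tail d1 (T : measurableType d1) (R : realType)
    (P : probability T R) (d m : nat) (ood : 'I_m -> {mfun T >-> bool})
    (G : 'I_m -> T -> d.-tuple R) (mu : d.-tuple R) (v t L : R)
    (q := 2 * d%:R * expR (- (t ^+ 2 / (2 * v)))) :
  ood_iid_sub_gaussian P ood G mu v -> (forall i, measurable_fun setT (G i)) ->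
  0 < v -> 0 < t -> 0 <= L ->
  let E := [set w | (0 < #|ood_set ood w|)%N /\
    (#|ood_set ood w|%:R * (q + Num.sqrt (L / (2 * #|ood_set ood w|%:R))) <=
      #|hits (ood_set ood w) G (far mu t) w|%:R)%R] in
  measurable E /\ (P E <= (expR (- L))%:E)%E.
Proof.
move=> HG mG v0 t0 L0 E.
have mO A := measurable_ood_set ood A.
pose s (A : {set 'I_m}) := Num.sqrt (L / (2 * #|A|%:R)).
pose B (A : {set 'I_m}) :=
  [set w | (#|A|%:R * (q + s A) <= #|hits A G (far mu t) w|%:R)%R].
have mB A : measurable (B A).
  exact: (measurable_hits _ mG (measurable_far mu t)
    [set K : {set 'I_m} | #|A|%:R * (q + s A) <= #|K|%:R]).
have mBO A : measurable (B A `&` [set w | ood_set ood w = A]).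
  exact: measurableI.
have mE : measurable E.
  have -> : E = \bigcup_(A in [set A : {set 'I_m} | (0 < #|A|)%N])
      (B A `&` [set w | ood_set ood w = A]).
    apply/seteqP; split => w /=; first by move=> [n0 Ow]; exists (ood_set ood w).
    by move=> [A A0 [Bw OA]]; split; rewrite OA.
  exact: fin_bigcup_measurable.
split=> //.
apply: (@le_trans _ _ (\sum_(A : {set 'I_m} | (0 < #|A|)%N)
    P (B A `&` [set w | ood_set ood w = A]))%E).
  by apply: le_measure_cover => // w [n0 Ow]; exists (ood_set ood w).
apply: (@le_trans _ _ (\sum_(A : {set 'I_m})
    (expR (- L))%:E * P [set w | ood_set ood w = A])%E).
  rewrite big_mkcond; apply: lee_sum => A _.
  case: ifPn => [A0|_]; last by rewrite mule_ge0// lee_fin expR_ge0.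
  (* A label pattern of probability zero has no conditional law to use, but it contributes
     nothing. *)
  have [PA0|PA0] := eqVneq (P [set w | ood_set ood w = A]) 0%E.
    rewrite PA0 mule0 -PA0.
    by apply: le_measure; [| |exact: subIsetr]; rewrite inE.
  have {}PA0 : (0 < P [set w | ood_set ood w = A])%E by rewrite lt0e PA0 /=.
  apply: conditioned_le => //.
  have [iG _ sG] := HG A PA0.
  have -> : - L = - (2 * #|A|%:R * s A ^+ 2).
    rewrite sqr_sqrtr ?divr_ge0//; congr (- _); field.
    by rewrite pnatr_eq0 -lt0n.
  apply: (hoeffding_hits mG (measurable_far mu t) iG).
  - by move=> i iA; apply: sub_gaussian_far => //; exact: sG.
  - by rewrite !mulr_ge0// expR_ge0.
  - exact: sqrtr_ge0.
by rewrite -ge0_sume_distrr// sum_prob_fibers ?mule1.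
Qed.

Theorem theorem4p4 (R : realType) (d m : nat)
    (p delta Delta sigma_out eps : R) (ref_grad : d.-tuple R)
    (dT dX : measure_display) (T : measurableType dT) (X : measurableType dX)
    (P : probability T R) (Pin Pout : probability X R)
    (ood : 'I_m -> {RV P >-> bool}) (x : 'I_m -> {RV P >-> X})
    (grad : {mfun X >-> d.-tuple R})
    (mid : R -> R -> R) (mu_out : d.-tuple R) (Sstar : T -> {set 'I_m}) :
  let G (i : 'I_m) (w : T) := grad (x i w) in
  let I := ind_set ood in
  let O := ood_set ood in
  (0 < d)%N -> (0 < m)%N ->
  0 < p -> p <= 1 / 2 ->
  0 < delta -> delta < 1 ->
  0 < Delta -> 0 < sigma_out ->
  0 < eps -> eps < Delta ->
  median_convention mid ->
  huber_model P p Pin Pout ood x ->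
  ood_iid_sub_gaussian P ood G mu_out (sigma_out ^+ 2) ->
  Delta * Num.sqrt d%:R <= l2dist mu_out ref_grad ->
  {ae P, forall w, (0 < #|I w|)%N ->
    l2dist (EWM mid (G ^~ w) (I w)) ref_grad < eps * Num.sqrt d%:R} ->
  (forall w, ideal_filter mid (G ^~ w) ref_grad #|I w| (Sstar w)) ->
  2 * ln (2 / delta) / p ^+ 2 <= m%:R ->
  exists E : set T,
    [/\ measurable E,
        ((1 - delta)%:E <= P E)%E
      & forall w, E w ->
          (1 <= #|O w|)%N /\
          err_out R (Sstar w) (O w) <=
            2 * d%:R * expR (- ((Delta - eps) ^+ 2 / (2 * sigma_out ^+ 2)))
            + 2 / p ^+ 2 * Num.sqrt (ln (2 / delta) / (2 * m%:R))
            + (1 - p) / (2 * p)].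
Proof.
move=> G I O d0 m0 p0 p2 delta0 delta1 Delta0 sigma0 eps0 epsD hmid Hhuber HG
  muref Hae Hstar mge.
set L := ln (2 / delta); set t := Delta - eps.
have t0 : 0 < t by rewrite subr_gt0.
have mR0 : 0 < m%:R :> R by rewrite ltr0n.
have L0 : 0 < L by rewrite ln_gt0// ltr_pdivlMr// mul1r; lra.
have eL : expR (- L) = delta / 2.
  by rewrite expRN lnK ?posrE ?divr_gt0// invf_div.
have v0 : 0 < sigma_out ^+ 2 by rewrite exprn_gt0.
set h := Num.sqrt (L / (2 * m%:R)).
have h0 : 0 <= h by exact: sqrtr_ge0.
have h2 : h ^+ 2 = L / (2 * m%:R) by rewrite sqr_sqrtr// divr_ge0 ?mulr_ge0// ltW.
have hp : h <= p / 2.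
  rewrite -(@ler_pXn2r _ 2)// ?nnegrE ?divr_ge0 ?(ltW p0)// h2.
  move: mge; rewrite ler_pdivrMr ?exprn_gt0// ler_pdivrMr ?mulr_gt0//.
  by rewrite -/L => mge; rewrite expr_div_n; lra.
have p1 : p <= 1 by lra.
have [mE1 PE1] := huber_ind_tail Hhuber p1 h0.
have mG i : measurable_fun setT (G i).
  exact: (measurableT_comp (measurable_funP grad) (measurable_funP (x i))).
have [mE2 PE2] := ood_far_tail HG mG v0 t0 (ltW L0).
set E1 := [set w | _] in mE1 PE1; set E2 := [set w | _] in mE2 PE2.
(* [N] is a measurable null set containing every failure of the median hypothesis; removing it makes
   that hypothesis pointwise on the good event. *)
have [N [mN PN0 NP]] := Hae.
have PN : P N = 0%E := PN0.
have mU : measurable (N `|` (E1 `|` E2)).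
  by apply: measurableU => //; exact: measurableU.
exists (~` (N `|` (E1 `|` E2))); split; first exact: measurableC.
  rewrite probability_setC// EFinB; apply: leeB => //.
  apply: (@le_trans _ _ (P N + (P E1 + P E2))%E).
    apply: le_trans (measureU2 _ mN (measurableU _ _ mE1 mE2)) _.
    by apply: leeD => //; exact: measureU2.
  rewrite PN add0e.
  (* Each bad event gets [delta / 2 = expR (- L)]; for [E1] this is [2 * m * h ^+ 2 = L]. *)
  have -> : delta%:E = ((delta / 2)%:E + (delta / 2)%:E)%E.
    by rewrite -EFinD; congr EFin; field.
  apply: leeD; last by rewrite -eL.
  have <- : expR (- (2 * m%:R * h ^+ 2)) = delta / 2; last exact: PE1.
  by rewrite -eL h2; congr (expR (- _)); field; lra.
move=> w /= /not_orP[Nw /not_orP[E1w E2w]].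
have IO : (#|I w| = m - #|O w|)%N.
  have : (#|O w| + #|I w| = m)%N := etrans (cardsC (O w)) (card_ord m).
  by move/(congr1 (subn^~ #|O w|)) => /=; rewrite addKn.
have Om : (#|O w| <= m)%N by rewrite -[leqRHS]card_ord max_card.
have {}E1w : m%:R - #|O w|%:R < m%:R * (1 - p + h) :> R.
  by rewrite -natrB// -IO ltNge; apply/negP.
(* Outside [E1] there are more than [m * (p - h) >= m * p / 2] OOD points, so the good event itself
   excludes an empty OOD set. *)
have OR0 : 0 < #|O w|%:R :> R.
  have : m%:R * (p / 2) <= m%:R * (p - h) by rewrite ler_pM2l//; lra.
  have : 0 < m%:R * (p / 2) by rewrite mulr_gt0// divr_gt0.
  lra.
have O0 : (0 < #|O w|)%N by rewrite -(ltr0n R).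
split=> //.
set s := Num.sqrt (L / (2 * #|O w|%:R)).
set q := 2 * _ * _.
have {}E2w : #|hits (O w) G (far mu_out t) w|%:R < #|O w|%:R * (q + s).
  by rewrite ltNge; apply/negP => ?; exact: E2w.
have [cS minS] := Hstar w.
have SI : (0 < #|Sstar w|)%N ->
    l2dist (EWM mid (G ^~ w) (Sstar w)) ref_grad < eps * Num.sqrt d%:R.
  rewrite cS => I0; apply: le_lt_trans (minS (I w) erefl) _.
  by apply: contrapT => nI; apply/Nw/NP => /= H; apply/nI/H.
have tE : (t + eps) * Num.sqrt d%:R <= l2dist mu_out ref_grad by rewrite subrK.
have := filter_contamination hmid eps0 t0 cS SI tE.
rewrite -/(hits (O w) G (far mu_out t) w) -/(I w) IO => cont.
apply: (@err_bound _ p h s q _ #|hits (O w) G (far mu_out t) w|%:R _ m%:R) => //.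
- by rewrite p0.
- by rewrite h0.
- exact: sqrtr_ge0.
- rewrite sqr_sqrtr ?divr_ge0 ?mulr_ge0 ?(ltW L0)// h2; field.
  by rewrite !lt0r_neq0.
- exact: ltW.
- exact: ltW.
- rewrite -natrB// -!natrM -natrD ler_nat !mul2n.
  exact: cont.
Qed.
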